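(* For every positive integer $d$, $\mathsf{s}_4(\mathbb{Z}_2^d) = \beta_4(d) + 3 = N(d,5) + 4$.
   Context: $\mathsf{s}_{4}(\mathbb{Z}_2^d)$ denotes the smallest integer $s$ such that every sequence (repetitions allowed) of length $s$ of elements of $\mathbb{Z}_2^d$ has a subsequence of length $4$ whose elements sum to $0$. $\beta_4(d)$ denotes the largest size of a set $A \subseteq \mathbb{Z}_2^d$ (of distinct elements) with no $4$-element subset summing to $0$. A linear binary code of length $n$ is a subspace $C \subseteq \mathbb{F}_2^n$; its redundancy is $n - \dim C$ and its distance is the minimum Hamming weight of a nonzero word (the zero code has distance $\infty$). $N(r,\delta)$ denotes the largest $n$ such that there is a linear binary code of length $n$, redundancy $r$ and distance at least $\delta$. *)

(* Defs.v *)
From HB Require Import structures.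
From mathcomp Require Import all_boot all_order all_algebra all_field.
From mathcomp Require Import boolp.

Set Implicit Arguments.
Unset Strict Implicit.
Unset Printing Implicit Defensive.

Import GRing.Theory.

(* 'F_2 is 'Z_2 by conversion, so 'rV['F_2]_d is both the group Z_2^d and the *)
(* vector space F_2^d.                                                        *)

Section ZeroSums.

Variable d : nat.

(* The sum being commutative, order-preserving subsequences lose no           *)
(* generality.                                                                *)
Definition has_zero_sum4 (s : seq 'rV['F_2]_d) : bool :=
  [exists t : 4.-tuple 'rV['F_2]_d, subseq t s && (\sum_(x <- t) x == 0)%R].

Definition s4_prop (n : nat) : bool :=
  [forall s : n.-tuple 'rV['F_2]_d, has_zero_sum4 s].

Lemma s4_exists : exists n, s4_prop n.
Proof.
exists (#|{: 'rV['F_2]_d}| * 3).+1; apply/forallP => s.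
have [x x4] : exists x, 3 < count_mem x s.
  apply/existsP; apply: contraT; rewrite negb_exists => /forallP cs.
  suff : size s <= #|{: 'rV['F_2]_d}| * 3 by rewrite size_tuple ltnn.
  move: (tval s) cs => l cl.
  rewrite -sum_nat_const -(sum1_size l) (partition_big id predT) //=.
  apply: leq_sum => x _.
  by rewrite sum1_count leqNgt; apply: cl.
apply/existsP; exists [tuple x; x; x; x]; apply/andP; split.
  have -> : tval [tuple x; x; x; x] = nseq 4 x by [].
  apply: (@subseq_trans _ (filter (pred1 x) s)); last exact: filter_subseq.
  have /all_pred1P -> : all (pred1 x) (filter (pred1 x) s) by exact: filter_all.
  rewrite size_filter -(subnKC x4) nseqD; exact: prefix_subseq.
apply/eqP; rewrite !big_cons big_nil; apply/rowP => i; rewrite !mxE addr0.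
have xx : (x 0 i + x 0 i = 0)%R by exact: (addrr_pchar2 (pchar_Fp (isT : prime 2))).
by rewrite addrA xx addr0.
Qed.

Definition s4 : nat := ex_minn s4_exists.

Definition zero_sum4_free (A : {set 'rV['F_2]_d}) : bool :=
  ~~ [exists B : {set 'rV['F_2]_d},
        [&& B \subset A, #|B| == 4 & (\sum_(x in B) x == 0)%R]].

(* The maximum is over a nonempty family: set0 is zero_sum4_free.             *)
Definition beta4 : nat := \max_(A | zero_sum4_free A) #|A|.

End ZeroSums.

Section Codes.

Variable n : nat.

Definition hamming_weight (v : 'rV['F_2]_n) : nat := #|[set i | (v 0 i != 0)%R]|.

Definition redundancy (C : {vspace 'rV['F_2]_n}) : nat := n - \dim C.

(* None stands for distance infinity. The vector vpick C, a nonzero word of C *)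
(* when C != 0, only witnesses that the minimum is over a nonempty set.       *)
Definition code_distance (C : {vspace 'rV['F_2]_n}) : option nat :=
  if C == 0%VS then None
  else Some (hamming_weight
    [arg min_(c < vpick C | (c \in C) && (c != 0)%R) hamming_weight c]).

Definition distance_at_least (C : {vspace 'rV['F_2]_n}) (delta : nat) : bool :=
  if code_distance C is Some k then delta <= k else true.

Lemma distance_at_leastP (C : {vspace 'rV['F_2]_n}) (delta : nat) :
  reflect (forall c, c \in C -> c != 0%R -> delta <= hamming_weight c)
          (distance_at_least C delta).
Proof.
rewrite /distance_at_least /code_distance.
have [->|nzC] := eqVneq C 0%VS.
  by apply: ReflectT => c; rewrite memv0 => ->.
case: arg_minnP => [|c /andP[Cc nzc] cmin]; first by rewrite memv_pick vpick0.
apply: (iffP idP) => [lek e Ce nze|]; last exact.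
by apply: leq_trans lek (cmin _ _); rewrite Ce.
Qed.

End Codes.

Definition code_exists (r delta n : nat) : bool :=
  `[< exists C : {vspace 'rV['F_2]_n},
        redundancy C = r /\ distance_at_least C delta >].

Lemma code_exists_ex r delta : exists n, code_exists r delta n.
Proof.
exists r; apply/asboolP; exists 0%VS; split; first by rewrite /redundancy dimv0 subn0.
by apply/distance_at_leastP => c; rewrite memv0 => ->.
Qed.

Lemma code_exists_bounded r delta :
  2 < delta -> forall n, code_exists r delta n -> n <= 2 ^ r.
Proof.
move=> d3 n /asboolP[C [rC /distance_at_leastP dC]].
pose e (i : 'I_n) : 'rV['F_2]_n := delta_mx 0%R i.
pose D := (C^C)%VS.
have CD : (D :&: C)%VS = 0%VS by rewrite capvC capv_compl.
have DC : (D + C)%VS = fullv by rewrite addvC addv_complf.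
have dimD : \dim D = r by rewrite /D dimv_compl dimvf dim_matrix mul1r.
pose f i := daddv_pi D C (e i).
have finj : injective f.
  move=> i j fij; apply/eqP; apply: contraT => nij.
  have Cij : (e i - e j)%R \in C.
    have ee k : e k = (f k + daddv_pi C D (e k))%R by rewrite daddv_pi_add ?DC ?memvf.
    rewrite (ee i) (ee j) fij opprD addrACA subrr add0r.
    by rewrite memvB ?memv_pi.
  have nz : (e i - e j != 0)%R.
    apply/eqP => /rowP/(_ i)/eqP; rewrite !mxE !eqxx (negbTE nij) subr0.
    by rewrite oner_eq0.
  have /(leq_trans d3) := dC _ Cij nz.
  suff le2 : hamming_weight (e i - e j) <= 2 by rewrite ltnNge le2.
  have c2 : #|[set i; j]| <= 2 by rewrite cards2 nij.
  apply: leq_trans c2; apply: subset_leq_card.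
  apply/subsetP => k; rewrite !inE !mxE eqxx /=.
  by case: (k == i); case: (k == j); rewrite ?subrr ?eqxx.
rewrite -[n]card_ord -(card_codom finj) -dimD.
have := card_vspace D; rewrite card_Fp // => <-.
apply: subset_leq_card; apply/subsetP => _ /codomP[i ->].
exact: memv_pi.
Qed.

(* For delta <= 2 the lengths need not be bounded, so 2 < delta is required   *)
(* for the largest length to exist.                                           *)
Definition N (r delta : nat) (delta_gt2 : 2 < delta) : nat :=
  ex_maxn (code_exists_ex r delta) (code_exists_bounded delta_gt2).

Arguments N r delta delta_gt2 : clear implicits.

(* Main.v *)
Require Import Defs.
From HB Require Import structures.
From mathcomp Require Import all_boot all_order all_algebra.
From mathcomp Require Import boolp zify.

(** A zero-sum sequence of four vectors over F_2 is either a rearrangement of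
    x, x, y, y or consists of four distinct vectors. Hence a longest sequence
    without zero-sum subsequence of length 4 is a largest 4-zero-sum-free set A
    with one element taken three times.
    Translating A so that it contains 0, the vectors of A \ {0} are the columns
    of a parity-check matrix of a code of distance at least 5, because sums of
    at most three of them can be padded with 0. By maximality A spans Z_2^d:
    otherwise a vector outside the span could be added. So the redundancy is
    exactly d. *)

Set Implicit Arguments.
Unset Strict Implicit.
Unset Printing Implicit Defensive.

Import GRing.Theory.

(** * Vectors in characteristic 2 *)

Section CharTwo.

Variable d : nat.
Implicit Types x y v : 'rV['F_2]_d.

Lemma addvv x : (x + x = 0)%R.
Proof.
by apply/rowP => i; rewrite !mxE (addrr_pchar2 (pchar_Fp (isT : prime 2))).
Qed.

Lemma oppv x : (- x = x)%R.
Proof. by apply/eqP; rewrite eq_sym -addr_eq0 addvv. Qed.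

Lemma addv_eq0 x y : (x + y == 0)%R = (x == y).
Proof. by rewrite addr_eq0 oppv. Qed.

End CharTwo.

(** * Zero-sum sequences of length 4 and zero-sum-free sets *)

Section ZeroSums.

Variable d : nat.
Implicit Types (s t : seq 'rV['F_2]_d) (A B : {set 'rV['F_2]_d}).

(** Sums ignore order, so inclusion of multisets can replace [subseq]. *)
Lemma has_zero_sum4P s :
  reflect (exists t, [/\ size t = 4, forall x, count_mem x t <= count_mem x s
                      & (\sum_(x <- t) x = 0)%R])
          (has_zero_sum4 s).
Proof.
apply: (iffP existsP) => [[t /andP[ts /eqP t0]]|[t [t4 /count_subseqP[u us tu] t0]]].
  exists t; split => //; first by rewrite size_tuple.
  by apply/count_subseqP; exists (tval t).
have u4 : size u == 4 by rewrite -(perm_size tu) t4.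
exists (Tuple u4) => /=; rewrite us /=.
by rewrite -(perm_big _ tu) /= t0.
Qed.

Lemma nuniq_count s : ~~ uniq s -> exists x, 1 < count_mem x s.
Proof.
move=> sn; apply/existsP; apply: contraNT sn; rewrite negb_exists => /forallP cs.
apply/count_mem_uniq => x; apply/eqP; rewrite eqn_leq.
by have := cs x; rewrite -leqNgt -has_pred1 has_count; case: count => [|[]].
Qed.

(** A repeated [x] cancels in characteristic 2, so the two remaining vectors sum to 0 and
    coincide. *)
Lemma zero_sum4_nuniq t : size t = 4 -> (\sum_(x <- t) x = 0)%R -> ~~ uniq t ->
  exists x y, perm_eq t [:: x; x; y; y].
Proof.
move=> t4 t0 /nuniq_count[x x2].
have xt : x \in t by rewrite -has_pred1 has_count; apply: leq_trans x2.
have xr : x \in rem x t.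
  by rewrite -has_pred1 has_count count_rem xt /= eqxx subn_gt0.
have pt : perm_eq t [:: x, x & rem x (rem x t)].
  by rewrite (permPl (perm_to_rem xt)) perm_cons perm_to_rem.
have := perm_size pt; rewrite t4 /=.
case: (rem _ _) pt => [|y [|z []]]// pt _.
move: t0; rewrite (perm_big _ pt) /= !big_cons big_nil addr0 addrA addvv add0r.
by move/eqP; rewrite addv_eq0 => /eqP yz; exists x, y; rewrite {2}yz.
Qed.

Lemma zero_sum4_freeP A :
  reflect (forall B, B \subset A -> #|B| = 4 -> (\sum_(x in B) x != 0)%R)
          (zero_sum4_free A).
Proof.
apply: (iffP idP) => [nA B BA B4|fA].
  by apply: contraNneq nA => B0; apply/existsP; exists B; rewrite BA B4 B0 !eqxx.
apply/existsPn => B; apply/negP => /and3P[BA /eqP B4]; exact/negP/(fA _ BA B4).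
Qed.

(** The alternatives are a zero-sum sequence with a repetition and one with four distinct terms. In
    the first, [x = y] is allowed and demands multiplicity 4. *)
Lemma has_zero_sum4E s :
  has_zero_sum4 s <->
  (exists x y, forall z, count_mem z [:: x; x; y; y] <= count_mem z s) \/
  ~~ zero_sum4_free [set x in s].
Proof.
split=> [/has_zero_sum4P[t [t4 ts t0]]|[[x [y xys]]|]].
- have [tu|/(zero_sum4_nuniq t4 t0)[x [y /permP txy]]] := boolP (uniq t); last first.
    by left; exists x, y => z; rewrite -txy.
  right; apply/negP => /zero_sum4_freeP/(_ [set x in t]).
  rewrite cardsE (card_uniqP tu) t4.
  rewrite (eq_bigl (mem t)) => [|x]; last by rewrite inE.
  rewrite -big_uniq //= t0 eqxx => ft; suff: false by []; apply: ft => //.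
  apply/subsetP => x; rewrite !inE -!has_pred1 !has_count => xt.
  exact: leq_trans xt (ts x).
- apply/has_zero_sum4P; exists [:: x; x; y; y]; split=> //.
  by rewrite !big_cons big_nil addr0 addrA !addvv.
- rewrite negbK => /existsP[B /and3P[/subsetP Bs /eqP B4 /eqP B0]].
  apply/has_zero_sum4P; exists (enum B); split; first by rewrite -cardE.
    move=> x; rewrite (count_uniq_mem _ (enum_uniq B)) mem_enum.
    by case: (boolP (x \in B)) => // /Bs; rewrite inE -has_pred1 has_count.
  by rewrite big_enum.
Qed.

Lemma leq_beta4 A : zero_sum4_free A -> #|A| <= beta4 d.
Proof. exact: leq_bigmax_cond. Qed.

Lemma beta4_attained : {A : {set 'rV['F_2]_d} | zero_sum4_free A & #|A| = beta4 d}.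
Proof.
have f0 : zero_sum4_free (set0 : {set 'rV['F_2]_d}).
  by apply/zero_sum4_freeP => B; rewrite subset0 => /eqP->; rewrite cards0.
have fn : 0 < #|@zero_sum4_free d| by apply/card_gt0P; exists set0.
by have [A fA eA] := eq_bigmax_cond (fun A => #|A|) fn; exists A.
Qed.

Lemma beta4_gt0 : 0 < beta4 d.
Proof.
rewrite -(cards1 (0%R : 'rV['F_2]_d)); apply: leq_beta4.
by apply/zero_sum4_freeP => B /subset_leq_card; rewrite cards1 => + B4; rewrite B4.
Qed.

Lemma s4_propP n :
  reflect (forall s, size s = n -> has_zero_sum4 s) (s4_prop d n).
Proof.
apply: (iffP forallP) => [fn s sn|fn s]; last by apply: fn; rewrite size_tuple.
by have /eqP sn' := sn; apply: (fn (Tuple sn')).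
Qed.

Lemma has_zero_sum4_subseq s t : subseq s t -> has_zero_sum4 s -> has_zero_sum4 t.
Proof.
move=> st /existsP[u /andP[us u0]]; apply/existsP; exists u.
by rewrite (subseq_trans us st).
Qed.

(** In a sequence without zero sum the distinct values form a free set, and at most one value
    repeats, at most three times. The length is thus at most [beta4 d + 2]. *)
Lemma s4_prop_beta4 : s4_prop d (beta4 d + 3).
Proof.
apply/s4_propP => s ss; apply: contraT => /negP ns.
have nxy x y : ~ forall z, count_mem z [:: x; x; y; y] <= count_mem z s.
  by move=> h; apply/ns/has_zero_sum4E; left; exists x, y.
have fs : zero_sum4_free [set x in s].
  by apply: contraT => h; case: ns; apply/has_zero_sum4E; right.
have := leq_beta4 fs; rewrite cardsE.
have [su|/nuniq_count[a a2]] := boolP (uniq s).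
  by rewrite (card_uniqP su) ss; lia.
have a3 : count_mem a s <= 3.
  rewrite leqNgt; apply/negP => a4; apply: (nxy a a) => z /=.
  by case: eqP => // <-.
(* A second repeated value [b] would give the pattern a, a, b, b. *)
have ru : uniq [seq x <- s | x != a].
  apply: contraT => /nuniq_count[b]; rewrite count_filter => b2.
  have ba : b != a.
    apply: contraTneq b2 => ->; rewrite (eq_count (a2 := pred0)) ?count_pred0 //.
    by move=> x /=; case: eqP.
  case: (nxy a b) => z /=; case: (eqVneq a z) => [<-|az].
    by rewrite (negPf ba); apply: leq_trans a2.
  case: eqP => // <-; apply: leq_trans b2 _; apply: sub_count => x /= /andP[] //.
have sa : a \in s by rewrite -has_pred1 has_count; apply: leq_trans a2.
(* Here [#|s|] counts distinct values: [a] and the terms different from [a]. *)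
have -> : #|s| = (size [seq x <- s | x != a]).+1.
  rewrite (cardD1 a) sa -(card_uniqP ru) add1n; congr _.+1.
  by apply: eq_card => x; rewrite mem_filter !inE.
have : count_mem a s + size [seq x <- s | x != a] = beta4 d + 3.
  by rewrite size_filter -ss; exact: (count_predC (pred1 a) s).
by lia.
Qed.

Lemma s4_prop_lower n : s4_prop d n -> beta4 d + 3 <= n.
Proof.
move=> /s4_propP sn; rewrite leqNgt; apply/negP; rewrite addn3 ltnS => nlt.
have [A fA cA] := beta4_attained.
have [a aA] : exists a, a \in A by apply/card_gt0P; rewrite cA beta4_gt0.
(* The third copy of [a] lies in [enum A]; the length is [beta4 d + 2], so a prefix of length [n]
   exists. *)
pose s := [:: a, a & enum A].
have ss : size (take n s) = n by rewrite size_takel //= -cardE cA.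
have := has_zero_sum4_subseq (take_subseq _ _) (sn _ ss).
have As : [set x in s] = A by apply/setP => x; rewrite !inE mem_enum; case: eqP => // ->.
have cs z : count_mem z s = (a == z).*2 + (z \in A).
  by rewrite /= (count_uniq_mem _ (enum_uniq A)) mem_enum addnA addnn.
move/has_zero_sum4E; rewrite As fA => -[[x [y xy]]|//].
(* Only [a] repeats, so x, x, y, y would need four copies of [a]. *)
have xa z : 1 < count_mem z s -> z = a.
  by rewrite cs; case: eqP => //; case: (z \in A).
have ex : x = a by apply/xa/(leq_trans _ (xy x)); rewrite /= eqxx.
have ey : y = a by apply/xa/(leq_trans _ (xy y)); rewrite /= eqxx; lia.
by have := xy a; rewrite cs ex ey /= eqxx aA.
Qed.

Lemma s4_eq : s4 d = beta4 d + 3.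
Proof.
rewrite /s4; case: ex_minnP => n /s4_prop_lower ln un.
by apply/eqP; rewrite eqn_leq ln un ?s4_prop_beta4.
Qed.

End ZeroSums.

(** * Parity-check columns and distance 5 *)

Section ParityCheck.

Variables d n : nat.
Implicit Types (A B : {set 'rV['F_2]_d}) (h : 'I_n -> 'rV['F_2]_d).

(** Any at most four columns are linearly independent: over F_2 a linear combination is a subset
    sum. *)
Definition indep4 h : Prop :=
  forall S : {set 'I_n}, S != set0 -> #|S| <= 4 -> (\sum_(i in S) h i != 0)%R.

Lemma indep4_inj h : indep4 h -> injective h.
Proof.
move=> hh i j hij; apply/eqP; apply: contraT => nij.
have := hh [set i; j]; rewrite cards2 nij -card_gt0 cards2 nij.
by rewrite big_setU1 ?inE //= big_set1 hij addvv eqxx => /(_ isT isT).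
Qed.

Lemma indep4_neq0 h i : indep4 h -> (h i != 0)%R.
Proof.
by move=> hh; have := hh [set i]; rewrite -card_gt0 cards1 big_set1; apply.
Qed.

Lemma indep4_free h : indep4 h ->
  zero_sum4_free (0%R |: [set h i | i : 'I_n]) /\
  #|0%R |: [set h i | i : 'I_n]| = n.+1.
Proof.
move=> hh; have hi := indep4_inj hh; split; last first.
  rewrite cardsU1 card_imset // card_ord.
  by case: imsetP => // -[i _ h0]; have := indep4_neq0 i hh; rewrite -h0 eqxx.
apply/zero_sum4_freeP => B /subsetP Bh B4; apply/negP => /eqP B0.
have eB : B :\ 0%R = [set h i | i in h @^-1: B].
  apply/setP => x; rewrite !inE; apply/andP/imsetP => [[x0 xB]|[i]].
    have := Bh x xB; rewrite !inE (negPf x0) => /imsetP[i _ xi].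
    by exists i; rewrite // inE -xi.
  by rewrite inE => hB ->; rewrite indep4_neq0.
have cB : #|B :\ 0%R| = #|h @^-1: B| by rewrite eB card_imset.
(* Dropping 0 from [B] leaves three or four columns with the same sum. *)
have := cardsD1 0%R B; rewrite B4 cB => c4.
have nS : h @^-1: B != set0.
  rewrite -card_gt0 lt0n; apply/eqP => S0; move: c4; rewrite S0.
  by case: (_ \in B).
have S4 : #|h @^-1: B| <= 4 by rewrite c4 leq_addl.
have /negP[] := hh _ nS S4.
rewrite -(big_imset id) /=; last by move=> i j _ _; apply: hi.
rewrite -eB; apply/eqP; rewrite -[RHS]B0.
have [zB|zB] := boolP (0%R \in B); last first.
  by apply: eq_bigl => x; rewrite !inE; case: eqP => // ->; rewrite (negPf zB).
by rewrite [RHS](big_setD1 0%R zB) /= add0r.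
Qed.

(** A vanishing sum of four columns contradicts freeness directly, one of three does after adding 0
    to the set; two columns would be equal and a single one would be 0. *)
Lemma zero_sum4_free_indep A h : zero_sum4_free A -> (0%R \in A)%R ->
  (forall i, h i \in A :\ 0%R) -> injective h -> indep4 h.
Proof.
move=> /zero_sum4_freeP fA zA hA hi S S0 S4; apply/negP => /eqP hS.
pose B := [set h i | i in S].
have cB : #|B| = #|S| by rewrite card_imset.
have BA : B \subset A :\ 0%R by apply/subsetP => _ /imsetP[i _ ->].
have sB : (\sum_(x in B) x = 0)%R.
  by rewrite big_imset //= => i j _ _; apply: hi.
have zB : 0%R \notin B by apply/negP => /(subsetP BA); rewrite !inE eqxx.
have {}BA : B \subset A by apply: subset_trans BA (subsetDl _ _).
move: S0 S4; rewrite -card_gt0 -cB => B0; rewrite leq_eqVlt => /orP[/eqP B4|].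
  by have := fA _ BA B4; rewrite sB eqxx.
rewrite ltnS leq_eqVlt => /orP[/eqP B3|B2].
  have := fA (0%R |: B); rewrite subUset sub1set zA BA cardsU1 zB B3.
  by rewrite big_setU1 //= sB addr0 eqxx => /(_ isT erefl).
move: B0; rewrite leq_eqVlt => /orP[/eqP/esym/eqP/cards1P[x Bx]|B1].
  by move: sB zB; rewrite Bx big_set1 => ->; rewrite inE eqxx.
have /cards2P[x [y [xy Bxy]]] : #|B| == 2 by rewrite eqn_leq -ltnS B2.
move: sB; rewrite Bxy big_setU1 ?inE //= big_set1 => /eqP.
by rewrite addv_eq0 (negPf xy).
Qed.

(** Nonzero coefficients are 1, so [f c] is the sum of the columns over the support of [c]. Nonzero
    codewords of weight at most 4 are therefore exactly the dependencies among at most four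
    columns. *)
Lemma indep4_code (f : {linear 'rV['F_2]_n -> 'rV['F_2]_d})
    (C : {vspace 'rV['F_2]_n}) :
  (forall c, (c \in C) = (f c == 0)%R) ->
  indep4 (fun i => f (delta_mx 0 i))%R <-> distance_at_least C 5.
Proof.
move=> fC.
have fE c : (f c = \sum_(i in [set i | c 0 i != 0]) f (delta_mx 0 i))%R.
  rewrite {1}(row_sum_delta c) linear_sum (bigID (fun i => c 0 i != 0))%R /=.
  rewrite [X in (_ + X)%R]big1 => [|i /negPn/eqP->]; last by rewrite scale0r linear0.
  rewrite addr0; apply: eq_big => [i|i ci]; first by rewrite inE.
  have -> : (c 0 i = 1)%R; last by rewrite scale1r.
  by apply/val_inj; move: (c 0%R i) ci => [[|[|]]].
split=> [ih|/distance_at_leastP dC S S0 S4].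
  apply/distance_at_leastP => c; rewrite fC fE => c0 nc; rewrite ltnNge.
  apply: contraTN c0 => cw; apply: ih => //; apply: contra nc => /eqP cs.
  apply/eqP/rowP => i; rewrite mxE; apply/eqP.
  by have := in_set0 i; rewrite -cs inE; case: eqP.
(* The word with support [S]. *)
pose c : 'rV['F_2]_n := (\row_i (i \in S)%:R)%R.
have cS : [set i | c 0 i != 0]%R = S.
  by apply/setP => i; rewrite inE mxE; case: (i \in S); rewrite ?eqxx ?oner_eq0.
apply/negP => s0; have := dC c; rewrite fC fE cS s0 /hamming_weight cS => /(_ isT).
rewrite leqNgt ltnS S4 => h; suff: false by []; apply: h.
apply: contra S0 => /eqP c0; rewrite -cS c0.
by apply/eqP/setP => i; rewrite !inE mxE eqxx.
Qed.

End ParityCheck.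

(** * Largest free sets and longest codes *)

Section CodeBound.

Variable d : nat.
Implicit Types A B : {set 'rV['F_2]_d}.

(** The map sends a word to the coordinates of its projection along [C] onto a complement, whose
    dimension is the redundancy. *)
Lemma parity_check_exists n (C : {vspace 'rV['F_2]_n}) : redundancy C = d ->
  exists f : {linear 'rV['F_2]_n -> 'rV['F_2]_d}, forall c, (c \in C) = (f c == 0)%R.
Proof.
have dimD : \dim (C^C)%VS = redundancy C.
  by rewrite dimv_compl dimvf dim_matrix mul1r.
(* Replacing [d] by the dimension of the complement makes the coordinate vector well typed without a
   cast. *)
rewrite -dimD => <-.
pose p := daddv_pi (C^C)%VS C.
pose g c := (\row_i coord (vbasis (C^C)%VS) i (p c))%R.
have gl : linear g by move=> a x y; apply/rowP => i; rewrite !mxE !linearP.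
pose gm := GRing.isLinear.Build _ _ _ _ g gl.
pose f : {linear 'rV['F_2]_n -> 'rV['F_2]_(\dim (C^C)%VS)} := HB.pack g gm.
have CD : (C^C :&: C)%VS = 0%VS by rewrite capvC capv_compl.
exists f => c; rewrite -[f c]/(g c).
have cE : c = (p c + daddv_pi C (C^C) c)%R.
  by rewrite daddv_pi_add // addvC addv_complf memvf.
apply/idP/eqP => [cC|g0].
  suff p0 : p c = 0%R by apply/rowP => i; rewrite !mxE p0 linear0.
  apply/eqP; rewrite -memv0 -CD memv_cap memv_pi /=.
  have -> : p c = (c - daddv_pi C (C^C) c)%R by rewrite {2}cE addrK.
  by rewrite memvB ?memv_pi.
suff p0 : p c = 0%R by rewrite cE p0 add0r memv_pi.
rewrite (coord_vbasis (memv_pi _ _ c)) -/p big1 // => i _.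
by have /rowP/(_ i) := g0; rewrite !mxE => ->; rewrite scale0r.
Qed.

Lemma code_beta4 n : code_exists d 5 n -> n < beta4 d.
Proof.
move=> /asboolP[C [/parity_check_exists[f fC] dC]].
have [fA <-] := indep4_free ((indep4_code fC).2 dC).
exact: leq_beta4.
Qed.

Lemma zero_sum4_free_translate A a :
  zero_sum4_free A -> zero_sum4_free [set (x + a)%R | x in A].
Proof.
move=> /zero_sum4_freeP fA; apply/zero_sum4_freeP => B BA B4.
have ai : injective (fun x : 'rV['F_2]_d => x + a)%R by exact: addIr.
have aK (x : 'rV['F_2]_d) : (x + a + a = x)%R by rewrite -addrA addvv addr0.
pose B' := [set (x + a)%R | x in B].
have BA' : B' \subset A.
  apply/subsetP => _ /imsetP[_ /(subsetP BA)/imsetP[x xA ->] ->].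
  by rewrite aK.
have := fA B' BA'; rewrite card_imset // => /(_ B4).
rewrite big_imset /=; last by move=> x y _ _; apply: ai.
(* Translation changes a sum of four vectors by 4a = 0. *)
by rewrite big_split /= sumr_const B4 -[4]/(2 + 2)%N mulrnDr addvv addr0.
Qed.

(** If [v] lies outside [U], a zero sum of four elements through [v] would make [v] a sum of three
    elements of [A], hence a member of [U]. So [v |: A] would be a larger free set. *)
Lemma max_free_span A (U : {vspace 'rV['F_2]_d}) :
  zero_sum4_free A -> #|A| = beta4 d -> {subset A <= U} -> U = fullv.
Proof.
move=> /zero_sum4_freeP fA cA AU; apply/eqP; rewrite eqEsubv subvf; apply/subvP => v _.
apply: contraT => vU.
have vA : v \notin A by apply: contra vU; apply: AU.
have : zero_sum4_free (v |: A).
  apply/zero_sum4_freeP => B BvA B4.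
  have [vB|vB] := boolP (v \in B); last first.
    apply: fA => //; apply/subsetP => x xB.
    have := subsetP BvA x xB; rewrite !inE => /orP[/eqP xv|//].
    by rewrite xv (negPf vB) in xB.
  rewrite (big_setD1 v) //= addv_eq0; apply: contraNneq vU => ->.
  apply: rpred_sum => x; rewrite !inE => /andP[xv xB]; apply: AU.
  by have := subsetP BvA x xB; rewrite !inE (negPf xv).
by move/leq_beta4; rewrite cardsU1 vA cA add1n ltnn.
Qed.

Lemma beta4_code : code_exists d 5 (beta4 d).-1.
Proof.
have [A0 fA0 cA0] := beta4_attained d.
have [a aA0] : exists a, a \in A0 by apply/card_gt0P; rewrite cA0 beta4_gt0.
pose A := [set (x + a)%R | x in A0].
have fA : zero_sum4_free A by exact: zero_sum4_free_translate.
have cA : #|A| = beta4 d by rewrite card_imset //; exact: addIr.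
have zA : 0%R \in A by apply/imsetP; exists a; rewrite ?addvv.
have <- : #|A :\ 0%R| = (beta4 d).-1 by rewrite -cA (cardsD1 0%R A) zA.
set n := #|_|.
pose h (i : 'I_n) : 'rV['F_2]_d := enum_val i.
(* Words are row vectors, so [H] is a transposed parity-check matrix. *)
pose H : 'M['F_2]_(n, d) := (\matrix_i h i)%R.
pose f : {linear 'rV['F_2]_n -> 'rV['F_2]_d} := mulmxr H.
pose C := lker (linfun f).
have fC c : (c \in C) = (f c == 0)%R by rewrite memv_ker lfunE.
have fh i : f (delta_mx 0 i)%R = h i by rewrite /= -rowE rowK.
apply/asboolP; exists C; split; last first.
  apply/(indep4_code fC) => S S0 S4.
  rewrite (eq_bigr h) => [|i _]; last exact: fh.
  apply: zero_sum4_free_indep fA zA _ _ S S0 S4; last exact: enum_val_inj.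
  by move=> i; apply: enum_valP.
(* Surjectivity makes the redundancy equal to [d], not merely at most [d]. *)
have full : limg (linfun f) = fullv.
  apply: max_free_span fA cA _ => x xA.
  have [->|x0] := eqVneq x 0%R; first exact: mem0v.
  have xA0 : x \in A :\ 0%R by rewrite !inE x0.
  rewrite -(enum_rankK_in xA0 xA0) -[enum_val _]/(h _) -fh -lfunE.
  exact: memv_img (memvf _).
have := limg_ker_dim (linfun f) fullv.
rewrite capfv full !dimvf !dim_matrix !mul1r -/C /redundancy => dimC.
by rewrite -[X in X - _]dimC addKn.
Qed.

Lemma N_beta4 : beta4 d = (N d 5 isT).+1.
Proof.
rewrite /N; case: ex_maxnP => n /code_beta4 nb /(_ _ beta4_code) bn.
apply/eqP; rewrite eqn_leq nb andbT.
by rewrite -(prednK (beta4_gt0 d)) ltnS.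
Qed.

End CodeBound.

Theorem theorem7 (d : nat) (d_gt0 : 0 < d) :
  s4 d = beta4 d + 3 /\ beta4 d + 3 = N d 5 isT + 4.
Proof. by rewrite s4_eq N_beta4 addSnnS. Qed.
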